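(* The polynomials $Q_n(x)$, $n\ge0$, are orthogonal with respect to some nondegenerate linear functional $\tau$ with moments $\tilde g_n=\langle\tau,x^n\rangle$ if and only if there exist complex coefficients $\nu_n$ ($n\ge 1$, all nonzero) and $R_{mk}$ ($0\le k\le m$) such that the system of algebraic equations $$\mu_n\,\tilde g_{n+m-1}=\nu_{m+1}\,g_{n+m+1}+R_{mm}\,g_{n+m}+R_{m,m-1}\,g_{n+m-1}+\dots+R_{m0}\,g_n,\qquad m,n=0,1,2,\dots$$ holds for some sequence $\tilde g_0,\tilde g_1,\dots$ of complex numbers (the left-hand side is understood to be $0$ for $n=0$, as $\mu_0=0$); the functional $\tau$ is the one with moments $\tilde g_n$.
   Context: All polynomials have complex coefficients. A linear functional on polynomials is nondegenerate if all Hankel determinants $\det|m_{i+k}|_{i,k=0}^{n-1}$, $n\ge1$, of its moments $m_n$ are nonzero. $\sigma$ is a nondegenerate linear functional with moments $g_n=\langle\sigma,x^n\rangle$, $g_0=1$, and $P_n(x)=x^n+O(x^{n-1})$ are its monic orthogonal polynomials: $\langle\sigma,P_nP_m\rangle=h_n\delta_{nm}$, $h_n\ne0$. A generalized derivative operator $\mathcal D$ is the linear operator on polynomials with $\mathcal D x^n=\mu_n x^{n-1}$, where $\mu_n$ are complex numbers with $\mu_0=0$ and $\mu_n\neq0$ for $n\ge1$. The derived monic polynomials are $Q_n(x)=\mu_{n+1}^{-1}\mathcal D P_{n+1}(x)$, $n\ge 0$. ''Orthogonal with respect to $\tau$'' means $\langle\tau,Q_nQ_m\rangle=\tilde h_n\delta_{nm}$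 with all $\tilde h_n\neq0$. *)

(* Defs.v *)
From HB Require Import structures.
From mathcomp Require Import all_boot all_order all_algebra.
From mathcomp Require Import complex reals.

Set Implicit Arguments.
Unset Strict Implicit.
Unset Printing Implicit Defensive.

Import Order.TTheory GRing.Theory Num.Theory.
Local Open Scope ring_scope.

(* The complex numbers are [R[i]] for [R : realType]; a linear functional on
   polynomials is an element of [{scalar {poly R[i]}}]. *)

Definition moment (R : realType) (s : {scalar {poly R[i]}}) (n : nat) : R[i] :=
  s 'X^n.

Definition nondegenerate_functional (R : realType) (s : {scalar {poly R[i]}}) : Prop :=
  forall n : nat, (0 < n)%N ->
    \det (\matrix_(i < n, k < n) moment s (i + k)%N) != 0.

Definition orthogonal_wrt (R : realType) (s : {scalar {poly R[i]}})
    (P : nat -> {poly R[i]}) : Prop :=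
  exists h : nat -> R[i],
    (forall n, h n != 0) /\
    (forall n m, s (P n * P m) = h n * (n == m)%:R).

(* [size p = n.+1] means that [p] has degree [n]. *)
Definition monic_orthogonal (R : realType) (s : {scalar {poly R[i]}})
    (P : nat -> {poly R[i]}) : Prop :=
  (forall n, P n \is monic /\ size (P n) = n.+1) /\ orthogonal_wrt s P.

(* At [n = 0] the second clause reads [D 1 = 0], since [mu 0 = 0]. *)
Definition generalized_derivative (R : realType) (mu : nat -> R[i])
    (D : {linear {poly R[i]} -> {poly R[i]}}) : Prop :=
  [/\ mu 0%N = 0,
      forall n, (0 < n)%N -> mu n != 0
    & forall n, D 'X^n = mu n *: 'X^(n.-1)].

Definition derived_poly (R : realType) (mu : nat -> R[i])
    (D : {linear {poly R[i]} -> {poly R[i]}}) (P : nat -> {poly R[i]})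
    (n : nat) : {poly R[i]} :=
  (mu n.+1)^-1 *: D (P n.+1).

(* [nu] is used only at positive indices and [r m k] only for [k <= m].  At
   [n = 0] the left-hand side vanishes because [mu 0 = 0], so the value of the
   truncated predecessor in the index of [gt] is then irrelevant. *)
Definition moment_system (R : realType) (mu g gt nu : nat -> R[i])
    (r : nat -> nat -> R[i]) : Prop :=
  forall m n : nat,
    mu n * gt (n + m).-1 =
    nu m.+1 * g (n + m + 1)%N + \sum_(k < m.+1) r m k * g (n + k)%N.

(* Main.v *)
Require Import Defs.
From HB Require Import structures.
From mathcomp Require Import all_boot all_order all_algebra.
From mathcomp Require Import complex reals.

Set Implicit Arguments.
Unset Strict Implicit.
Unset Printing Implicit Defensive.

Import Order.TTheory GRing.Theory Num.Theory.
Local Open Scope ring_scope.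

(** The system says that the transpose of D sends tau to sigma in a triangular
    way.  Put S_m = nu_(m+1) X^(m+1) + sum_(k <= m) r_(m k) X^k, a polynomial
    of degree exactly m + 1; by linearity the m-th block of equations is the
    single identity
      tau (X^m * D p) = sigma (p * S_m)   for every polynomial p
    ([moment_system_adjointP]).  Both directions evaluate it on the orthogonal
    basis p = P_j.

    If the identity holds, then mu_(n+1) tau (X^m Q_n) = sigma (P_(n+1) S_m),
    which vanishes for m < n, since then deg S_m < n + 1, and equals
    h_(n+1) nu_(n+1) <> 0 for m = n.  A monic family with this triangular
    behaviour against the monomials is orthogonal ([orthogonal_of_triangular])
    and forces the Hankel determinants of tau to be nonzero
    ([hankel_det_neq0]).

    Conversely, let Q be orthogonal for tau.  The form p |-> tau (X^m * D p)
    kills P_0, since D 1 = 0, and it kills P_(k+1) for k > m, since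
    Q_k is then orthogonal to X^m.  It is therefore represented by its finite
    Fourier sum along P_1, ..., P_(m+1), which is the required S_m; its
    leading coefficient is mu_(m+1) th_m / h_(m+1) <> 0, where th_m and
    h_(m+1) are the squared norms of Q_m and P_(m+1)
    ([adjoint_kernel_exists]). *)

(** * Monic families and orthogonality *)

Definition monic_family (F : fieldType) (P : nat -> {poly F}) : Prop :=
  forall n, P n \is monic /\ size (P n) = n.+1.

Lemma monic_family_coef (F : fieldType) (P : nat -> {poly F}) n :
  monic_family P -> (P n)`_n = 1.
Proof.
by move=> mP; have [/monicP + szP] := mP n; rewrite lead_coefE szP.
Qed.

Lemma poly_monomial_sum (F : fieldType) n (p : {poly F}) :
  (size p <= n)%N -> p = \sum_(k < n) p`_k *: 'X^k.
Proof.
move=> szp; rewrite -poly_def; apply/polyP => k; rewrite coef_poly.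
by case: ltnP => // le_nk; rewrite nth_default // (leq_trans szp).
Qed.

Lemma monic_family_span (F : fieldType) (P : nat -> {poly F}) n (p : {poly F}) :
  monic_family P -> (size p <= n)%N ->
  exists c : nat -> F, p = \sum_(k < n) c k *: P k.
Proof.
move=> mP; elim: n p => [|n IHn] p szp.
  exists (fun=> 0); rewrite big_ord0.
  by apply/eqP; rewrite -size_poly_eq0 -leqn0.
have [|c Ec] := IHn (p - p`_n *: P n).
  apply/leq_sizeP => j; rewrite leq_eqVlt coefB coefZ.
  case/predU1P => [<-|lt_nj].
    by rewrite (monic_family_coef _ mP) mulr1 subrr.
  have [_ szPn] := mP n.
  rewrite [p`_j]nth_default ?(leq_trans szp) //.
  by rewrite [(P n)`_j]nth_default ?szPn // mulr0 subr0.
exists (fun k => if k == n then p`_n else c k).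
rewrite big_ord_recr /= eqxx -[LHS](subrK (p`_n *: P n)) Ec; congr (_ + _).
by apply: eq_bigr => k _; rewrite ltn_eqF.
Qed.

(** Against a polynomial of degree at most n, P_n sees only the coefficient of
    X^n: this packages orthogonality to lower degrees together with the value
    in degree n. *)
Lemma orthogonal_coef (F : fieldType) (s : {scalar {poly F}})
    (P : nat -> {poly F}) (h : nat -> F) n (p : {poly F}) :
  monic_family P -> (forall i j, s (P i * P j) = h i * (i == j)%:R) ->
  (size p <= n.+1)%N -> s (P n * p) = h n * p`_n.
Proof.
move=> mP orthP /(monic_family_span mP)[c ->].
rewrite coef_sum mulr_sumr linear_sum mulr_sumr.
apply: eq_bigr => -[k lt_kSn] _ /=.
rewrite -scalerAr linearZ /= orthP coefZ mulrCA; congr (_ * (_ * _)).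
case: (ltngtP n k) => [lt_nk|lt_kn|->].
- by rewrite ltnS leqNgt lt_nk in lt_kSn.
- by rewrite nth_default //; have [_ ->] := mP k.
- by rewrite (monic_family_coef _ mP).
Qed.

(** By symmetry of the form one may take m <= n; then only the leading monomial
    of P_m can contribute. *)
Lemma orthogonal_of_triangular (F : fieldType) (s : {scalar {poly F}})
    (P : nat -> {poly F}) (h : nat -> F) :
  monic_family P ->
  (forall n m, (m <= n)%N -> s (P n * 'X^m) = h n * (n == m)%:R) ->
  forall n m, s (P n * P m) = h n * (n == m)%:R.
Proof.
move=> mP triP n m.
wlog le_mn : n m / (m <= n)%N.
  move=> IH; case/orP: (leq_total m n) => [/IH//|le_nm].
  rewrite mulrC IH // eq_sym; by case: eqP => [-> //|_]; rewrite !mulr0.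
have [_ szPm] := mP m.
rewrite (@poly_monomial_sum _ n.+1 (P m)) ?szPm //.
rewrite mulr_sumr linear_sum big_ord_recr big1 /=.
  rewrite add0r -scalerAr linearZ /= triP // eqxx mulr1 mulrC; congr (_ * _).
  case: eqP => [-> | /eqP neq_nm]; first exact: (monic_family_coef _ mP).
  by rewrite nth_default // szPm ltn_neqAle eq_sym neq_nm.
move=> k _.
by rewrite -scalerAr linearZ /= triP ?(ltnW (ltn_ord k)) // gtn_eqF // !mulr0.
Qed.

(** Multiplying the Hankel matrix on the left by the coefficient matrix of the
    family gives the matrix of all s (P_i * X^j), which is upper triangular
    with nonzero diagonal. *)
Lemma hankel_det_neq0 (F : fieldType) (s : {scalar {poly F}})
    (P : nat -> {poly F}) (h : nat -> F) :
  monic_family P -> (forall n, h n != 0) ->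
  (forall n m, (m <= n)%N -> s (P n * 'X^m) = h n * (n == m)%:R) ->
  forall n, \det (\matrix_(i < n, k < n) s 'X^(i + k)) != 0.
Proof.
move=> mP h_neq0 triP n; set H := (\matrix_(i, k) _).
pose L := \matrix_(i < n, k < n) (P i)`_k.
have LHE i j : (L *m H) i j = s (P i * 'X^j).
  rewrite mxE.
  have [_ szPi] := mP i.
  rewrite (@poly_monomial_sum _ n (P i)) ?szPi //.
  rewrite mulr_suml linear_sum; apply: eq_bigr => k _.
  by rewrite !mxE -scalerAl linearZ /= exprD.
have : \det (L *m H) != 0.
  rewrite -det_tr det_trig.
    by apply/prodf_neq0 => i _; rewrite mxE LHE triP // eqxx mulr1.
  apply/is_trig_mxP => i j lt_ij.
  by rewrite mxE LHE triP ?(ltnW lt_ij) // gtn_eqF // mulr0.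
by rewrite det_mulmx mulf_eq0 negb_or => /andP[].
Qed.

(** * The functional with prescribed moments *)

Definition moment_functional (F : fieldType) (gt : nat -> F) (p : {poly F}) : F :=
  \sum_(i < size p) p`_i * gt i.

Lemma moment_functional_widen (F : fieldType) (gt : nat -> F) n (p : {poly F}) :
  (size p <= n)%N -> moment_functional gt p = \sum_(i < n) p`_i * gt i.
Proof.
move=> le_pn; rewrite /moment_functional.
rewrite (big_ord_widen n (fun i => p`_i * gt i)) // big_mkcond.
by apply: eq_bigr => i _; case: ltnP => // le_pi; rewrite nth_default // mul0r.
Qed.

Lemma moment_functional_is_scalar (F : fieldType) (gt : nat -> F) :
  scalar (moment_functional gt).
Proof.
move=> a p q; pose n := maxn (size p) (size q).
have le_pn : (size p <= n)%N by rewrite leq_maxl.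
have le_qn : (size q <= n)%N by rewrite leq_maxr.
rewrite !(@moment_functional_widen _ _ n) //; last first.
  rewrite (leq_trans (size_polyD _ _)) // geq_max le_qn andbT.
  exact: leq_trans (size_scale_leq _ _) le_pn.
rewrite mulr_sumr -big_split; apply: eq_bigr => i _.
by rewrite coefD coefZ mulrDl mulrA.
Qed.

HB.instance Definition _ (F : fieldType) (gt : nat -> F) :=
  GRing.isLinear.Build F {poly F} F *%R (moment_functional gt)
    (@moment_functional_is_scalar F gt).

Lemma moment_functionalXn (F : fieldType) (gt : nat -> F) n :
  moment_functional gt 'X^n = gt n.
Proof.
rewrite /moment_functional size_polyXn big_ord_recr big1 /=.
  by rewrite coefXn eqxx mul1r add0r.
by move=> k _; rewrite coefXn ltn_eqF // mul0r.
Qed.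

(** * The derived polynomials *)

Lemma coef_generalized_derivative (R : realType) (mu : nat -> R[i])
    (D : {linear {poly R[i]} -> {poly R[i]}}) p k :
  generalized_derivative mu D -> (D p)`_k = mu k.+1 * p`_k.+1.
Proof.
move=> [mu0 _ DX].
rewrite (poly_monomial_sum (leqnn (size p))).
rewrite linear_sum !coef_sum mulr_sumr; apply: eq_bigr => -[j _] _ /=.
rewrite linearZ /= DX !coefZ !coefXn [RHS]mulrCA; congr (_ * _).
case: j => [|j] /=; first by rewrite mu0 mul0r mulr0.
by rewrite eqSS; case: eqP => [->//|_]; rewrite !mulr0.
Qed.

Lemma derived_poly_monic_family (R : realType) (mu : nat -> R[i])
    (D : {linear {poly R[i]} -> {poly R[i]}}) (P : nat -> {poly R[i]}) :
  generalized_derivative mu D -> monic_family P ->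
  monic_family (derived_poly mu D P).
Proof.
move=> dD mP n; have [_ mu_neq0 _] := dD.
have coefQ k : (derived_poly mu D P n)`_k
    = (mu n.+1)^-1 * (mu k.+1 * (P n.+1)`_k.+1).
  by rewrite coefZ (coef_generalized_derivative _ _ dD).
have coefQn : (derived_poly mu D P n)`_n = 1.
  by rewrite coefQ (monic_family_coef _ mP) mulr1 mulVf // mu_neq0.
have szQ : size (derived_poly mu D P n) = n.+1.
  apply/eqP; rewrite eqn_leq; apply/andP; split.
    apply/leq_sizeP => k lt_nk; rewrite coefQ nth_default ?mulr0 //.
    by have [_ ->] := mP n.+1.
  by rewrite ltnNge; apply/negP => /leq_sizeP/(_ n (leqnn n))/eqP;
    rewrite coefQn oner_eq0.
by rewrite monicE lead_coefE szQ coefQn.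
Qed.

Lemma generalized_derivative_derived (R : realType) (mu : nat -> R[i])
    (D : {linear {poly R[i]} -> {poly R[i]}}) (P : nat -> {poly R[i]}) n :
  generalized_derivative mu D -> D (P n.+1) = mu n.+1 *: derived_poly mu D P n.
Proof.
by move=> [_ mu_neq0 _]; rewrite /derived_poly scalerA mulfV ?scale1r ?mu_neq0.
Qed.

(** * The moment system as an adjunction *)

Definition system_poly (F : fieldType) (nu : nat -> F) (r : nat -> nat -> F)
    (m : nat) : {poly F} :=
  nu m.+1 *: 'X^(m.+1) + \poly_(k < m.+1) r m k.

Lemma size_system_poly (F : fieldType) (nu : nat -> F) (r : nat -> nat -> F) m :
  (size (system_poly nu r m) <= m.+2)%N.
Proof.
rewrite (leq_trans (size_polyD _ _)) // geq_max.
rewrite (leq_trans (size_scale_leq _ _)) ?size_polyXn //=.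
exact: leq_trans (size_poly _ _) (leqnSn _).
Qed.

Lemma coef_system_poly (F : fieldType) (nu : nat -> F) (r : nat -> nat -> F) m :
  (system_poly nu r m)`_m.+1 = nu m.+1.
Proof.
by rewrite coefD coefZ coefXn eqxx mulr1 coef_poly ltnn addr0.
Qed.

(** Both sides of the identity are linear in p, so it need only hold for
    p = X^n, where it is the (m, n) equation of the system.  For n = 0 the left
    side vanishes in either form, because mu_0 = 0. *)
Lemma moment_system_adjointP (R : realType) (sigma tau : {scalar {poly R[i]}})
    (mu gt nu : nat -> R[i]) (r : nat -> nat -> R[i])
    (D : {linear {poly R[i]} -> {poly R[i]}}) :
  generalized_derivative mu D -> (forall n, moment tau n = gt n) ->
  moment_system mu (moment sigma) gt nu r <->
  (forall m p, tau ('X^m * D p) = sigma (p * system_poly nu r m)).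
Proof.
move=> [mu0 _ DX] tauE.
have lhsE m n : tau ('X^m * D 'X^n) = mu n * gt (n + m).-1.
  rewrite DX -scalerAr linearZ /=; case: n => [|n]; first by rewrite mu0 !mul0r.
  by rewrite -exprD addnC -tauE.
have rhsE m n : sigma ('X^n * system_poly nu r m) =
    nu m.+1 * moment sigma (n + m + 1) + \sum_(k < m.+1) r m k * moment sigma (n + k).
  rewrite mulrDr linearD -scalerAr linearZ /= -exprD addn1 -addnS; congr (_ + _).
  rewrite poly_def mulr_sumr linear_sum; apply: eq_bigr => k _.
  by rewrite -scalerAr linearZ /= -exprD.
split=> [sys m p | adj m n]; last by rewrite -lhsE adj rhsE.
rewrite (poly_monomial_sum (leqnn (size p))).
rewrite linear_sum mulr_sumr mulr_suml !linear_sum; apply: eq_bigr => k _.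
by rewrite linearZ -scalerAr -scalerAl !linearZ /= lhsE rhsE sys.
Qed.

(** The Fourier sum has no P_0 term because D kills constants, and it stops at
    P_(m+1) because Q_k is orthogonal to X^m as soon as k > m. *)
Lemma adjoint_kernel_exists (R : realType) (sigma tau : {scalar {poly R[i]}})
    (P : nat -> {poly R[i]}) (mu : nat -> R[i])
    (D : {linear {poly R[i]} -> {poly R[i]}}) :
  generalized_derivative mu D -> monic_orthogonal sigma P ->
  orthogonal_wrt tau (derived_poly mu D P) ->
  forall m, exists S : {poly R[i]},
    [/\ (size S <= m.+2)%N, S`_m.+1 != 0
      & forall p, tau ('X^m * D p) = sigma (p * S)].
Proof.
move=> dD [mP [h [h_neq0 orthP]]] [th [th_neq0 orthQ]] m.
have mQ := derived_poly_monic_family dD mP.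
have [_ mu_neq0 _] := dD.
pose S := \sum_(k < m.+1) (tau ('X^m * D (P k.+1)) / h k.+1) *: P k.+1.
have tauQ k : (m <= k)%N ->
    tau ('X^m * D (P k.+1)) = mu k.+1 * (th k * (k == m)%:R).
  move=> le_mk; rewrite (generalized_derivative_derived _ _ dD) -scalerAr linearZ /=.
  congr (_ * _); rewrite mulrC (orthogonal_coef mQ orthQ) ?size_polyXn ?ltnS //.
  by rewrite coefXn.
have sigmaS j : sigma (P j * S) = tau ('X^m * D (P j)).
  rewrite mulr_sumr linear_sum /=.
  case: j => [|j].
    have [_ szP0] := mP 0.
    have -> : D (P 0) = 0.
      apply/polyP => k; rewrite (coef_generalized_derivative _ _ dD) coef0.
      by rewrite nth_default ?szP0 ?mulr0.
    rewrite mulr0 linear0 big1 // => k _.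
    by rewrite -scalerAr linearZ /= orthP !mulr0.
  have termE k : sigma (P j.+1 * ((tau ('X^m * D (P k.+1)) / h k.+1) *: P k.+1))
      = if k == j then tau ('X^m * D (P j.+1)) else 0.
    rewrite -scalerAr linearZ /= orthP eqSS eq_sym.
    by case: eqP => [->|_]; rewrite ?mulr0 // mulr1 divfK.
  rewrite (eq_bigr _ (fun (k : 'I_m.+1) _ => termE k)).
  have [lt_jm | lt_mj] := ltnP j m.+1.
    rewrite (bigD1 (Ordinal lt_jm)) //= eqxx big1 ?addr0 // => k neq_kj.
    by rewrite ifN.
  rewrite tauQ ?(ltnW lt_mj) // gtn_eqF // !mulr0 big1 // => k _.
  by rewrite ltn_eqF // (leq_trans (ltn_ord k)).
exists S; split.
- apply: (leq_trans (size_sum _ _ _)); apply/bigmax_leqP => k _.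
  apply: leq_trans (size_scale_leq _ _) _.
  by have [_ ->] := mP k.+1; rewrite !ltnS -ltnS.
- rewrite coef_sum big_ord_recr big1 /=.
    rewrite add0r coefZ (monic_family_coef _ mP) mulr1 tauQ // eqxx mulr1.
    by rewrite !mulf_neq0 ?invr_neq0 ?h_neq0 ?mu_neq0.
  move=> k _; rewrite coefZ nth_default ?mulr0 //.
  by have [_ ->] := mP k.+1; rewrite !ltnS.
move=> p.
have [c ->] := monic_family_span mP (leqnn (size p)).
rewrite linear_sum mulr_sumr mulr_suml !linear_sum; apply: eq_bigr => k _.
by rewrite linearZ -scalerAr -scalerAl !linearZ /= sigmaS.
Qed.

(** * The equivalence *)

Lemma moment_system_of_orthogonal (R : realType)
    (sigma tau : {scalar {poly R[i]}}) (P : nat -> {poly R[i]})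
    (mu : nat -> R[i]) (D : {linear {poly R[i]} -> {poly R[i]}}) :
  generalized_derivative mu D -> monic_orthogonal sigma P ->
  orthogonal_wrt tau (derived_poly mu D P) ->
  exists (nu : nat -> R[i]) (r : nat -> nat -> R[i]),
    (forall n, (0 < n)%N -> nu n != 0) /\
    moment_system mu (moment sigma) (moment tau) nu r.
Proof.
move=> dD oP oQ.
have [S S_spec] := boolp.choice (adjoint_kernel_exists dD oP oQ).
(* nu_n is the leading coefficient of S_(n-1), which has degree n. *)
exists (fun n => (S n.-1)`_n), (fun m k => (S m)`_k); split.
  by case=> // n _; have [] := S_spec n.
apply/(moment_system_adjointP _ _ _ dD (fun=> erefl)) => m p.
have [szS _ ->] := S_spec m; congr (sigma (p * _)).
apply/polyP => k; rewrite coefD coefZ coefXn coef_poly ltnS /=.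
case: (ltngtP k m.+1) => [lt_km|lt_mk|->].
- by rewrite -ltnS lt_km mulr0 add0r.
- by rewrite leqNgt (ltnW lt_mk) mulr0 addr0 nth_default // (leq_trans szS).
- by rewrite ltnn mulr1 addr0.
Qed.

Lemma orthogonal_of_moment_system (R : realType)
    (sigma tau : {scalar {poly R[i]}}) (P : nat -> {poly R[i]})
    (mu nu : nat -> R[i]) (r : nat -> nat -> R[i])
    (D : {linear {poly R[i]} -> {poly R[i]}}) :
  generalized_derivative mu D -> monic_orthogonal sigma P ->
  (forall n, (0 < n)%N -> nu n != 0) ->
  moment_system mu (moment sigma) (moment tau) nu r ->
  nondegenerate_functional tau /\ orthogonal_wrt tau (derived_poly mu D P).
Proof.
move=> dD [mP [h [h_neq0 orthP]]] nu_neq0.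
move=> /(moment_system_adjointP _ _ _ dD (fun=> erefl)) adj.
have mQ := derived_poly_monic_family dD mP.
have [_ mu_neq0 _] := dD.
pose th n := (mu n.+1)^-1 * (h n.+1 * nu n.+1).
have th_neq0 n : th n != 0 by rewrite !mulf_neq0 ?invr_neq0 ?mu_neq0 ?nu_neq0.
have triQ n m : (m <= n)%N ->
    tau (derived_poly mu D P n * 'X^m) = th n * (n == m)%:R.
  move=> le_mn; have szS := size_system_poly nu r m.
  rewrite /derived_poly -scalerAl linearZ /= mulrC [D _ * _]mulrC adj.
  rewrite (orthogonal_coef mP orthP) ?(leq_trans szS) //.
  rewrite /th [LHS]mulrC -!mulrA; congr (_ * (_ * _)).
  case: eqP => [->|/eqP neq_nm]; first by rewrite coef_system_poly mulr1.
  rewrite mulr0 nth_default // (leq_trans szS) // ltnS ltn_neqAle le_mn.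
  by rewrite eq_sym neq_nm.
split; first by move=> n _; apply: hankel_det_neq0 mQ th_neq0 triQ n.
by exists th; split=> // n m; apply: orthogonal_of_triangular.
Qed.

Theorem proposition3 (R : realType) (sigma : {scalar {poly R[i]}})
    (P : nat -> {poly R[i]}) (mu : nat -> R[i])
    (D : {linear {poly R[i]} -> {poly R[i]}})
    (sigma_nondeg : nondegenerate_functional sigma)
    (g0 : moment sigma 0 = 1)
    (P_orth : monic_orthogonal sigma P)
    (D_deriv : generalized_derivative mu D) :
  let Q := derived_poly mu D P in
  let g := moment sigma in
  ((exists tau : {scalar {poly R[i]}},
       nondegenerate_functional tau /\ orthogonal_wrt tau Q)
   <->
   (exists (nu : nat -> R[i]) (r : nat -> nat -> R[i]),
       (forall n, (0 < n)%N -> nu n != 0) /\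
       exists gt : nat -> R[i], moment_system mu g gt nu r))
  /\
  (forall gt : nat -> R[i],
     (exists tau : {scalar {poly R[i]}},
        [/\ forall n, moment tau n = gt n,
            nondegenerate_functional tau & orthogonal_wrt tau Q])
     <->
     (exists (nu : nat -> R[i]) (r : nat -> nat -> R[i]),
        (forall n, (0 < n)%N -> nu n != 0) /\
        moment_system mu g gt nu r)).
Proof.
move=> Q g.
have sys_to_tau gt nu r : (forall n, (0 < n)%N -> nu n != 0) ->
    moment_system mu g gt nu r ->
    exists tau : {scalar {poly R[i]}},
      [/\ forall n, moment tau n = gt n,
          nondegenerate_functional tau & orthogonal_wrt tau Q].
  move=> nu_neq0 sys.
  have tauE n : moment (moment_functional gt) n = gt n.
    exact: moment_functionalXn.
  have sys' : moment_system mu g (moment (moment_functional gt)) nu r.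
    by move=> m n; rewrite tauE.
  have [] := orthogonal_of_moment_system D_deriv P_orth nu_neq0 sys'.
  by exists (moment_functional gt).
split=> [|gt]; split.
- move=> [tau [_ oQ]].
  have [nu [r [nu_neq0 sys]]] := moment_system_of_orthogonal D_deriv P_orth oQ.
  by exists nu, r; split=> //; exists (moment tau).
- move=> [nu [r [nu_neq0 [gt /(sys_to_tau _ _ _ nu_neq0)[tau []]]]]].
  by exists tau.
- move=> [tau [tauE _ oQ]].
  have [nu [r [nu_neq0 sys]]] := moment_system_of_orthogonal D_deriv P_orth oQ.
  by exists nu, r; split=> // m n; rewrite -tauE.
- by move=> [nu [r [nu_neq0 sys]]]; apply: sys_to_tau nu_neq0 sys.
Qed.
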